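(* Let $d\ge 1$ be an integer. There exist constants $c_1,c_2>0$, depending only on $d$, such that for all integers $n\ge 1$ the number $f_d(n)$ of cops needed to win Covering (against a robber of speed $2$) on $[n]^d$ satisfies $c_1n^{\frac d2}\le f_d(n)\le c_2n^{\frac d2+1}$.
   Context: The grid $[n]^d$ is the graph with vertex set $\{1,\dots,n\}^d$ in which two distinct vertices are adjacent if and only if each coordinate differs by at most $1$ (so graph distance is the $l_\infty$ distance). The game of Covering on a graph $G$ is a perfect information game played by a team of cops and one robber, each occupying vertices of $G$ (several cops may occupy the same vertex). The cops choose the starting configuration, meaning the initial vertices of all the cops and of the robber. The two sides then take turns alternately forever, the cops going first. On the cops' turn, each cop moves to an adjacent vertex or stays put. On the robber's turn, he moves to any vertex at graph distance at most $2$ from his current vertex (possibly staying put). The cops win if after every one of their turns at least one cop occupies the same vertex as the robber. A number $m$ of cops ''can win'' if $m$ cops have a strategy guaranteeing this against every play of the robber; the number of cops needed to win Covering on $G$ is the minimum such $m$. *)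

(* Defs.v *)
From HB Require Import structures.
From mathcomp Require Import all_boot all_order all_algebra.
From mathcomp Require Import boolp reals exp.

Set Implicit Arguments.
Unset Strict Implicit.
Unset Printing Implicit Defensive.

Section Covering.

Variables (T : finType) (e : rel T).

Definition dist_le (k : nat) (x y : T) : Prop :=
  exists p : seq T, [/\ path e x p, last x p = y & size p <= k].

Variables (s m : nat).

Definition cop_config : Type := 'I_m -> T.

(* [:: (C_0, r_0); ...; (C_t, r_t)]: the positions of the cops and of the
   robber at the start of the game and after each of the t robber turns so
   far; it is then the cops' turn to move from C_t, the robber being on r_t. *)
Definition history : Type := seq (cop_config * T).

(* The cops' next configuration, given everything that happened so far. *)
Definition cop_strategy : Type := history -> cop_config.

Definition legal_cop_move (C C' : cop_config) : Prop :=
  forall i : 'I_m, C' i = C i \/ e (C i) (C' i).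

Definition robber_play (r0 : T) (r : nat -> T) : Prop :=
  r 0 = r0 /\ forall t, dist_le s (r t) (r t.+1).

Fixpoint hist (C0 : cop_config) (sigma : cop_strategy) (r : nat -> T)
    (t : nat) : history :=
  if t is t'.+1 then
    let h := hist C0 sigma r t' in rcons h (sigma h, r t'.+1)
  else [:: (C0, r 0)].

Definition cops_at (C0 : cop_config) (sigma : cop_strategy) (r : nat -> T)
    (t : nat) : cop_config :=
  if t is t'.+1 then sigma (hist C0 sigma r t') else C0.

(* The cops choose C0 and r0.  Their turn number t (t = 0, 1, ...) leads from
   cops_at t to cops_at t.+1, the robber standing on r t throughout. *)
Definition cops_can_win : Prop :=
  exists (C0 : cop_config) (r0 : T) (sigma : cop_strategy),
  forall r : nat -> T, robber_play r0 r ->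
  forall t : nat,
    legal_cop_move (cops_at C0 sigma r t) (cops_at C0 sigma r t.+1)
    /\ exists i : 'I_m, cops_at C0 sigma r t.+1 i = r t.

End Covering.

Section CopNumber.

Variables (T : finType) (e : rel T) (s : nat).

(* On the empty graph no starting configuration exists, so no number of cops
   can win; the value is then 0 by convention. *)
Definition cops_needed : nat :=
  match pselect (exists m, `[< cops_can_win e s m >]) with
  | left ex => ex_minn ex
  | right _ => 0
  end.

Lemma cops_can_win_card (x0 : T) : cops_can_win e s #|T|.
Proof.
exists (fun i => enum_val i), x0, (fun _ i => enum_val i) => r _ t; split.
  by move=> i; left; case: t.
by exists (enum_rank (r t)); rewrite /= enum_rankK.
Qed.

Lemma cops_neededP (x0 : T) :
  cops_can_win e s cops_needed /\
  forall m, cops_can_win e s m -> cops_needed <= m.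
Proof.
rewrite /cops_needed; case: pselect => [ex|[]]; last first.
  by exists #|T|; apply/asboolP/cops_can_win_card.
case: ex_minnP => m /asboolP winm minm; split=> // k wink.
by apply: minm; apply/asboolP.
Qed.

End CopNumber.

(* [n]^d, with the coordinates 1, ..., n shifted to 0, ..., n - 1. *)
Definition grid (d n : nat) : finType := {ffun 'I_d -> 'I_n}.

Definition grid_adj (d n : nat) : rel (grid d n) :=
  fun u v => (u != v) &&
    [forall i, (`|(u i : nat)%:Z - (v i : nat)%:Z| <= 1)%R].

Definition grid_cops_needed (d n : nat) : nat := cops_needed (@grid_adj d n) 2.

(* Main.v *)
Require Import Defs.
From HB Require Import structures.
From mathcomp Require Import all_boot all_order all_algebra.
From mathcomp Require Import boolp reals exp.
From mathcomp Require Import zify ring lra.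

(** Both bounds come from one question about the line: how many cops of speed 1
    are needed to be sure that, at one moment fixed in advance, s turns from
    now, one of them is on a robber of speed 2?  The answer is of order the
    square root of s.  On the grid the coordinates of a king move are
    independent, so the d-th power of this number, of order s to the d/2, is
    both necessary and sufficient there.

    Lower bound ([escape], [cops_necessary]).  Let the robber pick a sign in
    every coordinate and run straight with full speed in that direction, until
    a quarter of the s turns is left.  A cop can be useful afterwards only if
    he then is within three times the number of turns left, and the possible
    ends of the run are so far apart, compared with what a cop can walk in the
    meantime, that every cop is useful for at most one of the 2^d choices of
    signs.  By pigeonhole some choice leaves at most a fraction 2^-d of the
    cops useful.  With s of order n the robber has room for about log_4 n such
    runs once he has walked to a suitable point, and hence fewer than a
    constant times 2^(d log_4 n) = n^(d/2) cops fail to meet him at the end.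

    Upper bound ([chaser_hits], [cops_suffice]).  On the line, with s turns
    left and sg the square root of s, keep cops with equally spaced labels h in
    [-sg, sg] at the distances 2 sg h + h|h| from the robber.  This profile
    solves the transport equation of the problem: when the robber moves by v,
    moving the centre of the labels by v/2 times the decrease of sg turns the
    profile for s into the one for s - 1, no cop has to move by more than 1
    ([spread_step]), and only cops at the two ends of the range of labels are
    given up.  When the time is over, the label nearest to the centre is on the
    robber.  Real positions are truncated to integers and kept inside the line;
    there, a cop that walks towards such a slowly moving goal meets it within
    n - 1 turns ([chase_catches]), so a team can start its next round from any
    position.  Giving one cop to each vector of labels, one for each
    coordinate, makes a team of order n^(d/2) cops that is on the robber every
    n turns, and n teams with shifted rounds cover all turns. *)

Set Implicit Arguments.
Unset Strict Implicit.
Unset Printing Implicit Defensive.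

Import Order.TTheory GRing.Theory Num.Theory.
Local Open Scope ring_scope.

(** * The profile of a team on a line *)

(** The position, relative to the robber, of the cop with label [h] when
    [sg ^+ 2] turns are left.  For [0 <= h] it is [(sg + h) ^+ 2 - sg ^+ 2]; the
    extreme label [h = sg] is thus at distance three times the time left, which
    is the largest distance from which a robber running towards the cop can
    still be met at the end. *)
Definition spread (R : realType) (sg h : R) : R := 2 * sg * h + h * `|h|.

Lemma spreadN (R : realType) (sg h : R) : spread sg (- h) = - spread sg h.
Proof. by rewrite /spread normrN; ring. Qed.


(** Here [2 * w] is the move of the robber, [de] the decrease of the square root
    of the time left and [w * de] the move of the centre of the labels.  After
    the equation [2 * sg * de = 1 - de ^+ 2] is used, the claim is, in each of
    the four sign patterns of the old and the new label, a sum of products of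
    nonnegative factors, which are supplied explicitly.  For [w = 1] all cops to
    the left of the robber follow him with speed exactly 1, so there is no slack
    in the choice of the profile. *)
Lemma spread_step_le (R : realType) (sg de w h : R) :
  1 <= sg -> 0 <= de -> (sg + de) ^+ 2 = sg ^+ 2 + 1 -> -1 <= w <= 1 ->
  `|h - w * de| <= sg ->
  2 * w + spread sg (h - w * de) - spread (sg + de) h <= 1.
Proof.
move=> sg1 de0 sgE /andP[w_ge w_le] /ler_normlP[hge hle].
have de1 : 2 * (sg * de) = 1 - de ^+ 2.
  by move: sgE; rewrite !expr2 => e; lra.
have de_sq : 0 <= de ^+ 2 by exact: sqr_ge0.
have de_le : de <= 1.
  have : 1 * de <= sg * de by apply: ler_wpM2r.
  lra.
have de_sq1 : de ^+ 2 <= 1 by rewrite expr_le1.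
have wp : 0 <= 1 + w by lra.
have wm : 0 <= 1 - w by lra.
rewrite /spread.
case: (ger0P h) => h0; case: (ger0P (h - w * de)) => h'0.
- have -> : 2 * w + (2 * sg * (h - w * de) + (h - w * de) * (h - w * de)) -
      (2 * (sg + de) * h + h * h)
    = 2 * w - w * (2 * (sg * de)) + w ^+ 2 * de ^+ 2
      - 2 * de * h * (1 + w) by ring.
  rewrite de1.
  have := mulr_ge0 wp (mulr_ge0 de0 (addr_ge0 h0 h'0)).
  lra.
- have -> : 2 * w + (2 * sg * (h - w * de) + (h - w * de) * - (h - w * de)) -
      (2 * (sg + de) * h + h * h)
    = 2 * w - w * (2 * (sg * de)) - w ^+ 2 * de ^+ 2 - 2 * h ^+ 2
      - 2 * de * h * (1 - w) by ring.
  rewrite de1.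
  have wde : w * de ^+ 2 <= 1.
    have : 0 <= (1 - w) * de ^+ 2 by exact: mulr_ge0.
    lra.
  have p1 : 0 <= (1 - w) * (1 - w * de ^+ 2) by apply: mulr_ge0 => //; lra.
  have p2 := sqr_ge0 h.
  have p3 := mulr_ge0 wm (mulr_ge0 de0 h0).
  lra.
- have -> : 2 * w + (2 * sg * (h - w * de) + (h - w * de) * (h - w * de)) -
      (2 * (sg + de) * h + h * - h)
    = 2 * w - w * (2 * (sg * de)) + w ^+ 2 * de ^+ 2 + 2 * h ^+ 2
      - 2 * de * h * (1 + w) by ring.
  rewrite de1.
  have h_le : 0 <= - h by lra.
  have w_lt0 : 0 <= - w.
    rewrite leNgt; apply/negP => w0.
    have : 0 <= w * de by apply: mulr_ge0 => //; lra.
    lra.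
  have p1 := mulr_ge0 h_le h'0.
  have p2 := mulr_ge0 (mulr_ge0 w_lt0 de0) h'0.
  have p3 := mulr_ge0 (mulr_ge0 wp de0) h'0.
  have p4 : 0 <= - w * (1 - de ^+ 2) by apply: mulr_ge0 => //; lra.
  have p5 : 0 <= - w * (1 + w) * (1 - de ^+ 2).
    by rewrite !mulr_ge0 //; lra.
  have p6 : 0 <= - w * - w * (1 - de ^+ 2).
    by rewrite !mulr_ge0 //; lra.
  have p7 : 0 <= - w * (1 + w) by exact: mulr_ge0.
  lra.
- have -> : 2 * w + (2 * sg * (h - w * de) + (h - w * de) * - (h - w * de)) -
      (2 * (sg + de) * h + h * - h)
    = 2 * w - w * (2 * (sg * de)) - w ^+ 2 * de ^+ 2
      - 2 * de * h * (1 - w) by ring.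
  have p1 : 0 <= (1 - w) * de * (sg + (h - w * de)).
    by rewrite !mulr_ge0 //; lra.
  have p2 := mulr_ge0 (mulr_ge0 wm wp) de_sq.
  have p3 : (1 - w) * (2 * (sg * de)) = (1 - w) * (1 - de ^+ 2) by rewrite de1.
  rewrite de1; lra.
Qed.

(** The lower bound on the move is the upper bound for the mirrored game. *)
Lemma spread_step (R : realType) (sg de w h : R) :
  1 <= sg -> 0 <= de -> (sg + de) ^+ 2 = sg ^+ 2 + 1 -> -1 <= w <= 1 ->
  `|h - w * de| <= sg ->
  `|2 * w + spread sg (h - w * de) - spread (sg + de) h| <= 1.
Proof.
move=> sg1 de0 sgE w1 h_le; apply/ler_normlP; split; last first.
  exact: spread_step_le.
have := @spread_step_le R sg de (- w) (- h) sg1 de0 sgE.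
have -> : - h - - w * de = - (h - w * de) by ring.
rewrite !spreadN normrN => /(_ _ h_le).
have -> : -1 <= - w <= 1 by lra.
by move=> /(_ isT); lra.
Qed.

(** * Pursuit on a line *)

Definition near (k x y : nat) : bool := ((x <= y + k) && (y <= x + k))%N.

Lemma near_trans (k l x y z : nat) :
  near k x y -> near l y z -> near (k + l) x z.
Proof. by rewrite /near; lia. Qed.

Definition toward (x y : nat) : nat :=
  if (x < y)%N then x.+1 else if (y < x)%N then x.-1 else x.

Lemma near_toward (x y : nat) : near 1 x (toward x y).
Proof. by rewrite /near /toward; case: (ltngtP x y); lia. Qed.

Lemma toward_near (x y : nat) : near 2 x y -> near 1 (toward x y) y.
Proof. by rewrite /near /toward; case: (ltngtP x y); lia. Qed.

Lemma toward_lt (N x y : nat) : (x < N -> y < N -> toward x y < N)%N.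
Proof. by rewrite /toward; case: (ltngtP x y); lia. Qed.

(** As long as the pursuer has not met the goal he walks in one direction: the
    goal, as slow as he is, cannot jump over him.  After [N] steps he would be
    at an end of the line with the goal strictly beyond it. *)
Lemma chase_catches (tau q : nat -> nat) (N K : nat) :
  (forall k, k <= K -> tau k <= N)%N ->
  (forall k, (k < K)%N -> near 1 (tau k) (tau k.+1)) ->
  (forall k, (k < K)%N -> q k.+1 = toward (q k) (tau k.+1)) ->
  (q 0 <= N)%N -> (N <= K)%N -> q K = tau K.
Proof.
move=> tauN tau1 qS q0 NK.
have inv k : (k <= K)%N -> [\/ q k = tau k,
    (k <= q k)%N /\ (q k < tau k)%N | (q k + k <= N)%N /\ (tau k < q k)%N].
  elim: k => [_|k IH kK].
    case: (ltngtP (q 0%N) (tau 0%N)) => ?; first by constructor 2.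
      by constructor 3; rewrite addn0.
    by constructor 1.
  have := tau1 k kK; rewrite (qS k kK) /near /toward => tk.
  case: ltngtP => [lt|gt|->]; last by constructor 1.
    have [->|ne] := eqVneq (q k).+1 (tau k.+1); first by constructor 1.
    by case: (IH (ltnW kK)) => H; constructor 2; lia.
  have [->|ne] := eqVneq (q k).-1 (tau k.+1); first by constructor 1.
  by case: (IH (ltnW kK)) => H; constructor 3; lia.
have := tauN K (leqnn K); case: (inv K (leqnn K)) => //; lia.
Qed.

Lemma near_minn_truncn (R : realType) (N : nat) (a b : R) :
  `|b - a| <= 1 ->
  near 1 (minn N (Num.truncn a)) (minn N (Num.truncn b)).
Proof.
wlog suff half : a b / `|b - a| <= 1 -> (Num.truncn b <= (Num.truncn a).+1)%N.
  move=> ab; have := half _ _ ab; have := half b a; rewrite distrC => /(_ ab).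
  rewrite /near; lia.
move=> /ler_normlP[_ ab].
rewrite truncn_le_nat -natr1.
have := truncnS_gt a; lra.
Qed.

(** * A team that meets the robber once in every round *)

Section LineTeam.

Variables (R : realType) (n b : nat).

(** A round of team [j] consists of the [n] times with phases [0], ...,
    [n - 1], and the team is to be on the robber in the last phase. *)
Definition phase (j u : nat) : nat := ((u + j) %% n)%N.

(** The square root of the time left, plus one.  The profile is stopped at width
    1 and not 0, so that a whole interval of labels survives to the end. *)
Definition width (k : nat) : R := Num.sqrt (n - k)%:R.

(** The centre of the labels, which leans to the side to which the robber has
    moved in the current round. *)
Fixpoint center (j : nat) (x : nat -> nat) (u : nat) : R :=
  if u is u'.+1 then
    if phase j u == 0%N then 0
    else center j x u' + ((x u)%:R - (x u')%:R) / 2 *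
           (width (phase j u') - width (phase j u))
  else 0.

(** A spacing of 1/3 is fine enough for the last positions to be truncated to
    the position of the robber: the smallest nonnegative label then has
    [spread 1 h <= 2/3 + 1/9 < 1]. *)
Definition label (i : nat) : R := i%:R / 3 - b%:R.

(** [Num.truncn] is 0 on negative numbers, so this is the integral part of the
    desired position, moved to the nearest vertex of the line. *)
Definition target (j i : nat) (x : nat -> nat) (u : nat) : nat :=
  minn n.-1 (Num.truncn
    ((x u)%:R + spread (width (phase j u)) (label i - center j x u))).

(** The cop walks towards his target without ever being reset; a new round only
    moves the target. *)
Fixpoint chaser (j i : nat) (x : nat -> nat) (u : nat) : nat :=
  if u is u'.+1 then toward (chaser j i x u') (target j i x u) else 0%N.

Lemma chaser_le (j i : nat) (x : nat -> nat) (u : nat) :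
  (chaser j i x u <= n.-1)%N.
Proof. by elim: u => //= u IH; apply: (@toward_lt n.-1.+1) => //; apply: geq_minl. Qed.

Lemma chaser_prefix (j i : nat) (x y : nat -> nat) (u : nat) :
  (forall v, (v <= u)%N -> x v = y v) -> chaser j i x u = chaser j i y u.
Proof.
have center_prefix t : (forall v, (v <= t)%N -> x v = y v) ->
    center j x t = center j y t.
  elim: t => //= t IH xy; rewrite IH => [|v vt]; last by apply/xy/ltnW.
  by rewrite !xy.
elim: u => //= u IH xy; rewrite IH => [|v vu]; last by apply/xy/ltnW.
by rewrite /target center_prefix // xy.
Qed.

Lemma width_ge0 (k : nat) : 0 <= width k.
Proof. exact: sqrtr_ge0. Qed.

Lemma width_sq (k : nat) : width k ^+ 2 = (n - k)%:R.
Proof. by rewrite sqr_sqrtr. Qed.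

Lemma le_width (k l : nat) : (k <= l)%N -> width l <= width k.
Proof. by move=> kl; rewrite ler_sqrt // ler_nat; lia. Qed.

Lemma width_ge1 (k : nat) : (k < n)%N -> 1 <= width k.
Proof. by move=> kn; rewrite -[1]sqrtr1 ler_sqrt // ler1n; lia. Qed.

Lemma width_last : (0 < n)%N -> width n.-1 = 1.
Proof.
by move=> n0; rewrite /width (_ : n - n.-1 = 1)%N ?sqrtr1 //; lia.
Qed.

Lemma width_sqS (k : nat) : (k.+1 < n)%N -> width k ^+ 2 = width k.+1 ^+ 2 + 1.
Proof.
by move=> kn; rewrite !width_sq natr1; congr (_%:R); lia.
Qed.

Lemma phaseD (j u k : nat) :
  phase j u = 0%N -> (k < n)%N -> phase j (u + k) = k.
Proof.
by rewrite /phase => p0 kn; rewrite addnAC -modnDml p0 add0n modn_small.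
Qed.

Lemma half_speed (x y : nat) :
  near 2 x y -> (-1 : R) <= (y%:R - x%:R) / 2 <= (1 : R).
Proof.
move=> /andP[]; rewrite -!(ler_nat R) !natrD => xy yx.
by apply/andP; split; lra.
Qed.

Variable x : nat -> nat.
Hypothesis x_lt : forall u, (x u < n)%N.
Hypothesis x_near : forall u, near 2 (x u) (x u.+1).

Section Round.

Variables (j u0 : nat).
Hypothesis start : phase j u0 = 0%N.

Lemma center_start : center j x u0 = 0.
Proof. by case: u0 start => //= u ->. Qed.

Lemma centerS (k : nat) : (k.+1 < n)%N ->
  center j x (u0 + k.+1) = center j x (u0 + k) +
    ((x (u0 + k).+1)%:R - (x (u0 + k))%:R) / 2 * (width k - width k.+1).
Proof.
move=> kn; rewrite addnS /= -addnS !phaseD //; exact: ltnW.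
Qed.

(** The intervals of labels within [width] of the centre are nested, so a label
    that is still in use late in the round has been in use all the time. *)
Lemma center_drift (k l : nat) : (k <= l)%N -> (l < n)%N ->
  `|center j x (u0 + l) - center j x (u0 + k)| <= width k - width l.
Proof.
elim: l => [|l IH] kl ln; first by move: kl; rewrite leqn0 => /eqP ->; rewrite !subrr normr0.
move: kl; rewrite leq_eqVlt => /orP[/eqP ->|kl]; first by rewrite !subrr normr0.
have {}IH := IH kl (ltnW ln).
rewrite centerS // addrAC.
have /andP[w1 w2] := half_speed (x_near (u0 + l)).
set w := (_ / 2) in w1 w2 *.
have dw : 0 <= width l - width l.+1 by rewrite subr_ge0 le_width.
apply: le_trans (ler_normD _ _) _.
have : `|w * (width l - width l.+1)| <= width l - width l.+1.
  by rewrite normrM (ger0_norm dw) ler_piMl // ler_norml w1.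
lra.
Qed.

Lemma target_step (i k : nat) : (k.+1 < n)%N ->
  `|label i - center j x (u0 + k.+1)| <= width k.+1 ->
  near 1 (target j i x (u0 + k)) (target j i x (u0 + k.+1)).
Proof.
move=> kn; rewrite /target !phaseD //; last exact: ltnW.
have w1 := half_speed (x_near (u0 + k)).
have sw : width k = width k.+1 + (width k - width k.+1) by ring.
rewrite centerS // opprD addrA => viable.
apply: near_minn_truncn.
have dw : 0 <= width k - width k.+1 by rewrite subr_ge0 le_width.
have sq : (width k.+1 + (width k - width k.+1)) ^+ 2 = width k.+1 ^+ 2 + 1.
  by rewrite -sw width_sqS.
have := spread_step (width_ge1 kn) dw sq w1 viable.
rewrite -sw addnS; apply: le_trans; rewrite le_eqVlt; apply/orP; left.
by apply/eqP; congr `|_|; field.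
Qed.

Lemma target_last (i : nat) : (0 < n)%N ->
  0 <= label i - center j x (u0 + n.-1) <= 3^-1 ->
  target j i x (u0 + n.-1) = x (u0 + n.-1).
Proof.
move=> n0 /andP[h0 h1].
rewrite /target phaseD ?width_last //; last by lia.
set h := label i - _ in h0 h1 *.
rewrite (truncn_def (n := x (u0 + n.-1))).
  by have := x_lt (u0 + n.-1); lia.
have hh : 0 <= h * h by exact: mulr_ge0.
have hh1 : h * h <= 3^-1 * 3^-1 by exact: ler_pM.
rewrite /spread ger0_norm // -natr1; apply/andP; split; lra.
Qed.

(** The label is chosen in hindsight: it is the first one above the final
    centre.  The target of the cop with this label has moved slowly during the
    whole round, so that the cop is on it at the end. *)
Lemma chaser_hits : (0 < n)%N -> (n <= b ^ 2)%N ->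
  exists2 i, (i < 6 * b + 1)%N & chaser j i x (u0 + n.-1) = x (u0 + n.-1).
Proof.
move=> n0 nb.
have width0 : width 0 <= b%:R.
  by rewrite -(ler_pXn2r (n := 2)) ?nnegrE ?width_ge0 // width_sq -natrX ler_nat; lia.
set c := center j x (u0 + n.-1).
have c_le : `|c| <= b%:R - 1.
  have := @center_drift 0 n.-1 isT; rewrite addn0 center_start subr0 width_last //.
  by rewrite ltn_predL => /(_ n0); rewrite -/c; lra.
have /ler_normlP[c1 c2] := c_le.
have y0 : 0 <= 3 * (c + b%:R) by lra.
have /andP[i1 i2] := truncn_itv y0.
set i0 := Num.truncn _ in i1 i2; rewrite -natr1 in i2.
exists i0.+1.
  rewrite -(ltr_nat R) -natr1 natrD natrM; lra.
have h_small : 0 <= label i0.+1 - c <= 3^-1.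
  by rewrite /label -natr1; apply/andP; split; lra.
rewrite -(target_last (i := i0.+1)) //.
apply: (@chase_catches (fun k => target j i0.+1 x (u0 + k))
                       (fun k => chaser j i0.+1 x (u0 + k)) n.-1 n.-1).
- by move=> k _; rewrite geq_minl.
- move=> k kn; apply: target_step; first by lia.
  have := @center_drift k.+1 n.-1 kn; rewrite width_last // ltn_predL => /(_ n0).
  rewrite -/c => drift.
  have -> : label i0.+1 - center j x (u0 + k.+1)
          = (label i0.+1 - c) + (c - center j x (u0 + k.+1)) by ring.
  apply: le_trans (ler_normD _ _) _.
  by case/andP: h_small => ? ?; rewrite (ger0_norm (x := _ - c)) //; lra.
- by move=> k kn; rewrite addnS.
- by rewrite addn0 chaser_le.
- by [].
Qed.

End Round.

End LineTeam.

(** * From positions computed online to a winning strategy *)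

Section OnlineStrategy.

Variables (T : finType) (e : rel T) (s : nat).

Lemma size_hist (m : nat) (C0 : cop_config T m) sigma r t :
  size (hist C0 sigma r t) = t.+1.
Proof. by elim: t => //= t IH; rewrite size_rcons IH. Qed.

Lemma nth_hist (m : nat) (C0 : cop_config T m) sigma r t k z : (k <= t)%N ->
  (nth z (hist C0 sigma r t) k).2 = r k.
Proof.
elim: t => [|t IH] /=; first by rewrite leqn0 => /eqP ->.
rewrite leq_eqVlt nth_rcons size_hist => /orP[/eqP ->|kt].
  by rewrite ltnn eqxx.
by rewrite kt IH.
Qed.

(** The cops [pos i] need [w] turns of preparation, which the game does not
    give.  They pretend that the robber has stood on [r0] for [w + 1] turns
    before the start: they play against the path delayed by [w + 1], of which
    the part before the start is known to them when they choose their initial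
    positions. *)
Lemma online_strategy_wins (I : finType) (pos : I -> (nat -> T) -> nat -> T)
    (w : nat) (r0 : T) :
  (forall i f g u, (forall v, (v <= u)%N -> f v = g v) ->
    pos i f u = pos i g u) ->
  (forall i f u, pos i f u.+1 = pos i f u \/ e (pos i f u) (pos i f u.+1)) ->
  (forall f, (forall u, dist_le e s (f u) (f u.+1)) ->
    forall u, (w <= u)%N -> exists i, pos i f u = f u) ->
  cops_can_win e s #|I|.
Proof.
move=> pos_prefix pos_legal pos_hits.
pose C0 : cop_config T #|I| := fun i => pos (enum_val i) (fun=> r0) w.
pose sigma (h : history T #|I|) : cop_config T #|I| := fun i =>
  pos (enum_val i) (fun u => (nth (C0, r0) h (u - w.+1)).2) (w + size h)%N.
exists C0, r0, sigma => r [r_start r_step] t.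
pose f u := r (u - w.+1)%N.
have f_step u : dist_le e s (f u) (f u.+1).
  rewrite /f; have [uw|uw] := leqP w.+1 u; first by rewrite subSn.
  by rewrite (_ : _ - _ = u - w.+1)%N; [exists [::] | lia].
have posE t' i : cops_at C0 sigma r t' i = pos (enum_val i) f (w + t')%N.
  case: t' => [|t'] /=.
    rewrite addn0 /C0; apply: pos_prefix => v vw.
    by rewrite /f (_ : _ - _ = 0)%N ?r_start //; lia.
  rewrite /sigma size_hist; apply: pos_prefix => v vw.
  by rewrite nth_hist //; lia.
split=> [i|].
  by rewrite !posE addnS; apply: pos_legal.
have [i fi] := pos_hits f f_step (w + t.+1)%N (leq_addr _ _).
exists (enum_rank i); rewrite posE enum_rankK fi /f; congr r; lia.
Qed.

End OnlineStrategy.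

(** * The upper bound on the grid *)

Lemma adj_near (d n : nat) (u v : grid d n) :
  (forall k, near 1 (u k) (v k)) -> v = u \/ grid_adj u v.
Proof.
move=> uv; have [->|ne] := eqVneq v u; [by left | right].
rewrite /grid_adj eq_sym ne; apply/forallP => k.
by have := uv k; rewrite /near; lia.
Qed.

Lemma grid_adj_near (d n : nat) (u v : grid d n) k :
  grid_adj u v -> near 1 (u k) (v k).
Proof. by move=> /andP[_ /forallP/(_ k)]; rewrite /near; lia. Qed.

Lemma dist_le_near (d n s : nat) (u v : grid d n) k :
  dist_le (@grid_adj d n) s u v -> near s (u k) (v k).
Proof.
move=> [p []]; elim: p s u => [|w p IH] s u /=.
  by move=> _ -> _; rewrite /near; lia.
move=> /andP[uw wp] lastp; case: s => // s ps.
exact: near_trans (grid_adj_near k uw) (IH _ _ wp lastp ps).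
Qed.

Lemma near_dist_le (d n : nat) (u v : grid d n) :
  (forall k, near 2 (u k) (v k)) -> dist_le (@grid_adj d n) 2 u v.
Proof.
move=> uv.
have mid_lt k : (toward (u k) (v k) < n)%N by exact: toward_lt.
pose w : grid d n := [ffun k => Ordinal (mid_lt k)].
have uw : w = u \/ grid_adj u w.
  by apply: adj_near => k; rewrite ffunE near_toward.
have wv : v = w \/ grid_adj w v.
  by apply: adj_near => k; rewrite ffunE toward_near.
case: uw wv => [->|uw] [->|wv].
- by exists [::].
- by exists [:: v]; rewrite /= wv.
- by exists [:: w]; rewrite /= uw.
- by exists [:: w; v]; rewrite /= uw wv.
Qed.

(** Cop [(j, l)] plays in coordinate [k] as the cop with label [l k] of team
    [j].  Which label is good may differ from coordinate to coordinate, and all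
    combinations are present. *)
Lemma cops_suffice (R : realType) (d n b : nat) : (0 < n)%N -> (n <= b ^ 2)%N ->
  (grid_cops_needed d n <= n * (6 * b + 1) ^ d)%N.
Proof.
case: n => // n _ nb.
pose I : finType := ('I_n.+1 * {ffun 'I_d -> 'I_(6 * b + 1)})%type.
have cardI : #|I| = (n.+1 * (6 * b + 1) ^ d)%N.
  by rewrite card_prod card_ffun !card_ord.
have r0 : grid d n.+1 := [ffun=> ord0].
have [_ ->] := cops_neededP (@grid_adj d n.+1) 2 r0; first by [].
pose pos (i : I) (f : nat -> grid d n.+1) u : grid d n.+1 :=
  [ffun k => inord (chaser R n.+1 b i.1 (i.2 k) (fun v => f v k) u)].
have posE i f u k :
    pos i f u k = chaser R n.+1 b i.1 (i.2 k) (fun v => f v k) u :> nat.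
  by rewrite ffunE inordK // ltnS; apply: chaser_le.
rewrite -cardI; apply: (@online_strategy_wins _ _ _ I pos n r0).
- move=> i f g u fg; apply/ffunP => k; rewrite !ffunE; congr inord.
  by apply: chaser_prefix => v vu; rewrite fg.
- by move=> i f u; apply: adj_near => k; rewrite !posE near_toward.
move=> f f_step u nu.
pose u0 := (u - n)%N.
(* The team whose current round began at u0 = u - n; its last phase is at u. *)
have jP : ((n.+1 - u0 %% n.+1) %% n.+1 < n.+1)%N by rewrite ltn_mod.
pose j : 'I_n.+1 := Ordinal jP.
have start : phase n.+1 j u0 = 0%N.
  rewrite /phase /= modnDmr -modnDml subnKC ?modnn //.
  by rewrite ltnW // ltn_mod.
have hit k : exists l : 'I_(6 * b + 1),
    chaser R n.+1 b j l (fun v => f v k) u = f u k.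
  have f_near v : near 2 (f v k) (f v.+1 k) by exact: dist_le_near.
  have [l lb] := @chaser_hits R n.+1 b (fun v => f v k) (fun v => ltn_ord _)
                   f_near j u0 start isT nb.
  by rewrite subnK // => <-; exists (Ordinal lb).
have [l lP] := fin_all_exists hit.
exists (j, [ffun k => l k]); apply/ffunP => k; apply/val_inj.
by rewrite /= posE /= ffunE.
Qed.

(** * The escape of the robber *)

Local Open Scope nat_scope.

Lemma near_widen (k l x y : nat) : k <= l -> near k x y -> near l x y.
Proof. by rewrite /near; lia. Qed.

Lemma near_drift (c k t : nat) (f : nat -> nat) :
  (forall u, near c (f u) (f u.+1)) -> near (c * k) (f t) (f (t + k)).
Proof.
move=> f_near; elim: k => [|k IH]; first by rewrite addn0 /near; lia.
by rewrite mulnSr addnS; apply: near_trans (f_near _).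
Qed.

(** The number of turns needed for [K] straight runs.  The recursion is
    [runway K.+1 = (3 * runway K + 1) + runway K]: the next run has length
    [3 * runway K + 1], the least [a] such that no cop can be near both ends of
    a run in one coordinate.  These are [4 * a] apart, the cop walks at most [a]
    to either side during the run, and near means within [3 * runway K], so the
    condition is [4 * a > 2 * (a + 3 * runway K)]. *)
Fixpoint runway (K : nat) : nat := if K is K'.+1 then (4 * runway K' + 1) else 0.

Lemma runwayE (K : nat) : (3 * runway K + 1 = 4 ^ K).
Proof. by elim: K => //= K; rewrite expnS; lia. Qed.

Definition run (x : nat) (up : bool) (c : nat) : nat :=
  if up then (x + 2 * c) else (x - 2 * c).

Section Escape.

Variables (d n m : nat) (C0 : cop_config (grid d n) m) (r0 : grid d n).
Variable sigma : cop_strategy (grid d n) m.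

Let play := robber_play (@grid_adj d n) 2 r0.
Let cops r t := cops_at C0 sigma r t.

Hypothesis cops_legal : forall r, play r -> forall t,
  legal_cop_move (@grid_adj d n) (cops r t) (cops r t.+1).

Lemma cops_prefix r r' t :
  (forall u, (u <= t) -> r u = r' u) -> cops r t.+1 = cops r' t.+1.
Proof.
suff hist_prefix u : (forall v, (v <= u) -> r v = r' v) ->
    hist C0 sigma r u = hist C0 sigma r' u.
  by move=> rr'; rewrite /cops /= hist_prefix.
elim: u => [|u IH] rr' /=; first by rewrite rr'.
by rewrite IH ?rr' // => v vu; rewrite rr' // ltnW.
Qed.

Lemma cops_drift r t k i j : play r ->
  near k (cops r t i j) (cops r (t + k) i j).
Proof.
move=> playr; rewrite -[k in near k]mul1n.
apply: (near_drift _ _ (f := fun u => cops r u i j)) => u.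
case: (cops_legal playr u i) => [->|]; first by rewrite /near; lia.
exact: grid_adj_near.
Qed.

Lemma robber_drift r t k j : play r -> near (2 * k) (r t j) (r (t + k) j).
Proof.
move=> [_ r_step]; apply: (near_drift _ _ (f := fun u => r u j)) => u.
exact: dist_le_near (r_step u).
Qed.

Lemma straight_run r t a (eps : {ffun 'I_d -> bool}) : play r ->
  (forall j, (2 * a <= r t j) /\ (r t j + 2 * a < n)) ->
  exists r', [/\ play r', forall u, (u <= t) -> r' u = r u &
    forall j, r' (t + a) j = run (r t j) (eps j) a :> nat].
Proof.
move=> [r_start r_step] room.
pose pos c : grid d n :=
  [ffun j => insubd (r t j) (run (r t j) (eps j) (minn c a))].
have posE c j : pos c j = run (r t j) (eps j) (minn c a) :> nat.
  rewrite ffunE val_insubd ifT //.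
  by have [] := room j; rewrite /run; case: (eps j); lia.
have pos0 : pos 0 = r t.
  apply/ffunP => j; apply/val_inj; rewrite /= posE min0n /run.
  by case: (eps j); rewrite ?addn0 ?subn0.
exists (fun u => if (u <= t) then r u else pos (u - t)); split.
- split=> [|u]; first by rewrite leq0n.
  have [ut|tu] := ltnP u t; first by rewrite (ltnW ut).
  have -> : (if (u <= t) then r u else pos (u - t)) = pos (u - t).
    case: ifP => // ut; have -> : u = t by lia.
    by rewrite subnn pos0.
  apply: near_dist_le => j; rewrite !posE subSn // /run.
  by have [] := room j; rewrite /near; case: (eps j); lia.
- by move=> u ->.
- move=> j; rewrite addKn.
  have [->|a0] := posnP a; first by rewrite addn0 leqnn -[in LHS]pos0 posE min0n.
  by rewrite ifF ?posE ?minnn //; lia.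
Qed.

(** One straight run reduces the set [A] of cops to be feared by a factor [2 ^ d].
    The choice of the run may depend on the strategy of the cops, as its answers
    to all [2 ^ d] runs are determined by the position reached. *)
Lemma escape K r t (A : {set 'I_m}) : play r ->
  (forall j, (2 * runway K <= r t j) /\ (r t j + 2 * runway K < n)) ->
  (#|A| < 2 ^ (d * K)) ->
  exists r', [/\ play r', forall u, (u <= t) -> r' u = r u &
    forall i, i \in A -> cops r' (t + runway K).+1 i <> r' (t + runway K)].
Proof.
elim: K r t A => [|K IH] r t A playr room Asmall.
  exists r; split=> // i; suff -> : A = set0 by rewrite inE.
  by apply/eqP; rewrite -cards_eq0; move: Asmall; rewrite muln0; case: #|A|.
pose s := runway K; pose a := (3 * s + 1).
have aS : runway K.+1 = (a + s) by rewrite /a /s /=; lia.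
have run_ex (eps : {ffun 'I_d -> bool}) : exists r', [/\ play r', forall u, (u <= t) -> r' u = r u &
    forall j, r' (t + a) j = run (r t j) (eps j) a :> nat].
  by apply: straight_run => // j; have := room j; rewrite aS; lia.
have [rr rrP] := fin_all_exists run_ex.
pose viable eps i :=
  [forall j, near (3 * s) (cops (rr eps) (t + a).+1 i j) (rr eps (t + a) j)].
(* Cops are at the same place at time t.+1 for all runs, as only the robber's
   moves up to time t have been seen by then. *)
have viable_uniq i : (\sum_eps viable eps i <= 1).
  rewrite -big_mkcond sum1_card; apply/card_le1_eqP => e1 e2.
  rewrite !unfold_in => v1 v2; apply/ffunP => j; apply/eqP/negPn/negP => ne.
  move/forallP/(_ j): v1; move/forallP/(_ j): v2.
  have [p1 pre1 end1] := rrP e1; have [p2 pre2 end2] := rrP e2.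
  have := @cops_drift _ t.+1 a i j p1; have := @cops_drift _ t.+1 a i j p2.
  rewrite !addSn end1 end2 (cops_prefix pre1) (cops_prefix pre2).
  have [] := room j; rewrite aS /run /near.
  by case: (e1 j) (e2 j) ne => [] [] //= _; lia.
have [eps epsP] : exists eps, (#|[set i in A | viable eps i]| < 2 ^ (d * K)).
  apply/existsP; rewrite -[[exists _, _]]negbK negb_exists.
  apply/negP => /forallP large.
  have : (\sum_(eps : {ffun 'I_d -> bool}) 2 ^ (d * K)
          <= \sum_(eps : {ffun 'I_d -> bool}) #|[set i in A | viable eps i]|).
    by apply: leq_sum => eps _; rewrite leqNgt.
  rewrite sum_nat_const card_ffun card_bool card_ord -expnD -mulnS leqNgt.
  move=> /negP; apply; apply: leq_ltn_trans Asmall.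
  have cardE eps : #|[set i in A | viable eps i]| = (\sum_(i in A) viable eps i).
    by rewrite -sum1dep_card -big_mkcondr.
  rewrite (eq_bigr _ (fun eps _ => cardE eps)) exchange_big /= -sum1_card.
  by apply: leq_sum => i _.
have [play1 pre1 end1] := rrP eps.
have room1 j : (2 * s <= rr eps (t + a) j) /\
    (rr eps (t + a) j + 2 * s < n).
  by have [] := room j; rewrite aS end1 /run; case: (eps j); lia.
have [r' [play' pre' esc]] := IH (rr eps) (t + a) _ play1 room1 epsP.
exists r'; split=> // [u ut|i iA].
  by rewrite pre' ?pre1 //; lia.
rewrite aS addnA; have [vi|] := boolP (viable eps i).
  by apply: esc; rewrite inE iA.
(* A cop that is not viable is too far away: during the remaining s turns the
   robber approaches him by at most 2 * s and he walks at most s. *)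
case/forallPn => j /negP far caught; apply: far.
rewrite -(cops_prefix pre') -pre' //.
have := @cops_drift _ (t + a).+1 s i j play'.
have := @robber_drift _ (t + a) s j play'.
rewrite addSn caught; rewrite /near; lia.
Qed.

End Escape.

(** The robber's start is chosen by the cops, so he first walks to a point that
    is [2 * runway K] away from the boundary, where [escape] applies to all the
    cops. *)
Lemma cops_necessary (d n K : nat) : (4 ^ K.+1 <= 3 * n + 1) ->
  (2 ^ (d * K) <= grid_cops_needed d n).
Proof.
move=> nK; pose s := runway K.
have centre_lt : (2 * s < n).
  by have := runwayE K; rewrite -/s; rewrite expnS in nK; lia.
case: n nK centre_lt => // n nK centre_lt.
have x0 : grid d n.+1 := [ffun=> ord0].
have [+ _] := cops_neededP (@grid_adj d n.+1) 2 x0.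
rewrite -/(grid_cops_needed d n.+1); move: (grid_cops_needed _ _) => m.
move=> [C0 [r0 [sigma win]]]; rewrite leqNgt; apply/negP => m_small.
pose move_in (v : grid d n.+1) : grid d n.+1 :=
  [ffun k => Ordinal (toward_lt (ltn_ord (v k)) centre_lt)].
pose r u := iter u move_in r0.
have play_r : robber_play (@grid_adj d n.+1) 2 r0 r.
  split=> // u; apply: near_dist_le => k.
  by rewrite /r iterS ffunE; apply: (@near_widen 1) => //; apply: near_toward.
have centred k : r n k = (2 * s) :> nat.
  apply: (@chase_catches (fun=> 2 * s) (fun u => r u k) n n) => //.
  - by move=> u _; rewrite /near; lia.
  - by move=> u _; rewrite /r iterS ffunE.
  - by rewrite -ltnS.
have room k : (2 * s <= r n k) /\ (r n k + 2 * s < n.+1).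
  rewrite centred; split=> //.
  by have := runwayE K; rewrite -/s; rewrite expnS in nK; lia.
have legal r' (p : robber_play (@grid_adj d n.+1) 2 r0 r') t :=
  proj1 (win r' p t).
have A_small : (#|[set: 'I_m]| < 2 ^ (d * K)) by rewrite cardsT card_ord.
have [r' [play' _ esc]] := escape legal play_r room A_small.
have [_ [i]] := win r' play' (n + s).
by apply: esc; rewrite inE.
Qed.

Local Open Scope ring_scope.

(** * The two bounds *)

Lemma powR_half_nat (R : realType) (n d : nat) :
  n%:R `^ (d%:R / 2) = Num.sqrt n%:R ^+ d :> R.
Proof. by rewrite mulrC powRrM powR12_sqrt // powR_mulrn ?sqrtr_ge0. Qed.

Theorem corollary2p2 (R : realType) (d : nat) (hd : (1 <= d)%N) :
  exists c1 c2 : R, [/\ 0 < c1, 0 < c2 &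
    forall n : nat, (1 <= n)%N ->
      c1 * n%:R `^ (d%:R / 2) <= (grid_cops_needed d n)%:R /\
      (grid_cops_needed d n)%:R <= c2 * n%:R `^ (d%:R / 2 + 1)].
Proof.
exists (4 ^+ d)^-1, (14 ^+ d); split; rewrite ?invr_gt0 ?exprn_gt0 // => n n1.
have n_neq0 : n%:R != 0 :> R by rewrite pnatr_eq0; lia.
rewrite powRD ?n_neq0 ?implybT // powRr1 // powR_half_nat.
set q := Num.sqrt _.
have q0 : 0 <= q by exact: sqrtr_ge0.
have qq : q ^+ 2 = n%:R by exact: sqr_sqrtr.
have q1 : 1 <= q by rewrite -(ler_pXn2r (n := 2)) ?nnegrE // qq expr1n ler1n.
split.
(* The robber has room for L.-1 runs, where 4 ^ L <= n < 4 ^ L.+1; the square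
   root of n is at most 2 ^ L.+1 <= 4 * 2 ^ L.-1. *)
- pose L := trunc_log 4 n; pose K := L.-1.
  have L_le : (4 ^ L <= n)%N by exact: trunc_logP.
  have L_gt : (n < 4 ^ L.+1)%N by exact: trunc_log_ltn.
  have K_le : (4 ^ K.+1 <= 3 * n + 1)%N.
    by rewrite /K; case: (L) L_le => [|l] /= L_le; rewrite ?expn1; lia.
  have q_le : q <= 4 * 2 ^+ K.
    rewrite -(ler_pXn2r (n := 2)) ?nnegrE ?mulr_ge0 ?exprn_ge0 // qq.
    rewrite exprMn -exprM mulnC exprM -natrX -!natrX -natrM ler_nat.
    apply: (leq_trans (ltnW L_gt)).
    by rewrite /K; case: (L) => [|l] //=; rewrite -(expnD 4 2 l).
  have := cops_necessary d K_le; rewrite -(ler_nat R).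
  apply: le_trans; rewrite ler_pdivrMl ?exprn_gt0 //.
  rewrite mulnC expnM natrX natrX -exprMn.
  by apply: lerXn2r; rewrite ?nnegrE ?mulr_ge0 ?exprn_ge0.
(* With b <= 2 * q the 6 * b + 1 labels are at most 14 * q. *)
- pose b := (Num.truncn q).+1.
  have /andP[b1 b2] := truncn_itv q0.
  have b_le : b%:R <= 2 * q by rewrite /b -natr1; lra.
  have nb : (n <= b ^ 2)%N.
    rewrite -(ler_nat R) natrX -qq ler_pXn2r ?nnegrE // ltW //.
  have := @cops_suffice R d n b n1 nb; rewrite -(ler_nat R) => /le_trans; apply.
  rewrite natrM natrX mulrC mulrA -exprMn ler_wpM2r //.
  apply: lerXn2r; rewrite ?nnegrE ?mulr_ge0 //.
  rewrite natrD natrM; lra.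
Qed.
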